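(* Let $X$ be a discrete random variable with $n$ values and probabilities $p(x_1),\dots,p(x_n)$ ($p(x_i)\ge0$, $\sum_{i=1}^n p(x_i)=1$). With the choice $h(\lambda,q)=\lambda^{1-q}$, the Tsallis hypoentropy $H_{\lambda,q}(X)$ is a monotonically increasing (nondecreasing) function of $\lambda>0$ when $0\le q\le 2$, and a monotonically decreasing (nonincreasing) function of $\lambda>0$ when $q\ge2$ or $q\le0$.
   Context: The $q$-logarithm is $\ln_q(x)=\frac{x^{1-q}-1}{1-q}$ for $x>0$ and real $q\neq 1$, with $\ln_1=\log$ (the limit $q\to1$). The Tsallis hypoentropy with $h(\lambda,q)=\lambda^{1-q}$ is, for $\lambda>0$ and real $q$, $$H_{\lambda,q}(X)=\frac{\lambda^{1-q}}{\lambda}\left\{-(1+\lambda)\ln_q\frac{1}{1+\lambda}+\sum_{i=1}^n(1+\lambda p(x_i))\ln_q\frac{1}{1+\lambda p(x_i)}\right\}.$$ *)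

(* Defs.v *)
From mathcomp Require Import all_boot all_order all_algebra.
From mathcomp Require Import reals exp.

Set Implicit Arguments.
Unset Strict Implicit.
Unset Printing Implicit Defensive.

Import Order.TTheory GRing.Theory Num.Theory.
Local Open Scope ring_scope.

(* The q-logarithm; only meaningful for 0 < x. *)
Definition lnq (R : realType) (q x : R) : R :=
  if q == 1 then ln x else (x `^ (1 - q) - 1) / (1 - q).

(* A random variable with n values enters only through its probabilities
   p i = p(x_i). *)
Definition is_prob (R : realType) (n : nat) (p : 'I_n -> R) : Prop :=
  (forall i, 0 <= p i) /\ \sum_(i < n) p i = 1.

(* The Tsallis hypoentropy for a general prefactor h(lambda, q). *)
Definition tsallis_hypoentropy (R : realType) (h : R -> R -> R)
    (lambda q : R) (n : nat) (p : 'I_n -> R) : R :=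
  h lambda q / lambda *
    (- (1 + lambda) * lnq q (1 / (1 + lambda))
     + \sum_(i < n) (1 + lambda * p i) * lnq q (1 / (1 + lambda * p i))).

Definition hpow (R : realType) (lambda q : R) : R := lambda `^ (1 - q).

(* Main.v *)
Require Import Defs.
From mathcomp Require Import all_boot all_order all_algebra.
From mathcomp Require Import ring lra.
From mathcomp Require Import boolp reals topology normedtype derive realfun exp.

Set Implicit Arguments.
Unset Strict Implicit.
Unset Printing Implicit Defensive.

Import Order.TTheory GRing.Theory Num.Theory.
Import numFieldNormedType.Exports.
Local Open Scope ring_scope.

(* With t = 1/lambda and phi x = x^q / (1 - q) (- x ln x if q = 1), so that
   phi'' x = - q x^(q-2) for every q,
     H = \sum_i (phi (t + p_i) - phi t) - (phi (t + 1) - phi t).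
   For 0 < s <= t put d x = phi (x + t) - phi (x + s); the increment of H
   between s and t is \sum_i (d p_i - d 0) - (d 1 - d 0).  If phi'' is
   nondecreasing (0 <= q <= 2) then d is convex, so d p_i - d 0 is at most
   p_i (d 1 - d 0), and summing over i bounds the increment by 0.  If phi'' is
   nonincreasing, apply this to - phi. *)

Lemma MVT_ge (R : realType) (f df : R -> R) (m a b : R) :
  (forall x : R, m <= x -> is_derive x 1 f (df x)) -> m <= a -> a < b ->
  exists c, [/\ a < c, c < b & f b - f a = df c * (b - a)].
Proof.
move=> fd ma ab.
have [x||c] := @MVT R f df a b ab.
- by rewrite in_itv/= => /andP[ax _]; apply: fd; rewrite (le_trans ma) ?ltW.
- apply: derivable_within_continuous => x; rewrite in_itv/= => /andP[ax _].
  by have [] := fd x (le_trans ma ax).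
- by rewrite in_itv/= => /andP[ac cb] E; exists c.
Qed.

(** The shift [s > 0] keeps the argument positive, so the derivative exists even at the endpoint
    [x = 0], where [f] itself need not be differentiable. *)
Lemma is_derive_shift_gt0 (R : realType) (f df : R -> R) (s x : R) :
  (forall y : R, 0 < y -> is_derive y 1 f (df y)) -> 0 < s -> 0 <= x ->
  is_derive x 1 (fun y : R => f (y + s)) (df (x + s)).
Proof.
move=> fd s0 x0; have xs : 0 < x + s by rewrite ltr_wpDl.
have := is_derive1_comp (g := shift s) (fd _ xs) (is_derive_shift x 1 s).
by rewrite mulr1.
Qed.

Section nondecreasing_second_derivative.
Context {R : realType} (f df ddf : R -> R).
Hypothesis fd : forall x : R, 0 < x -> is_derive x 1 f (df x).
Hypothesis dfd : forall x : R, 0 < x -> is_derive x 1 df (ddf x).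
Hypothesis ddf_nd : forall x y : R, 0 < x -> x <= y -> ddf x <= ddf y.

Let is_derive_increment (g dg : R -> R) (s t x : R) :
  (forall y : R, 0 < y -> is_derive y 1 g (dg y)) ->
  0 < s -> 0 < t -> 0 <= x ->
  is_derive x 1 (fun y : R => g (y + t) - g (y + s)) (dg (x + t) - dg (x + s)).
Proof.
move=> gd s0 t0 x0.
exact: is_deriveB (is_derive_shift_gt0 gd t0 x0)
  (is_derive_shift_gt0 gd s0 x0).
Qed.

(** This is the convexity of [d]: its second derivative [ddf (z + t) - ddf (z + s)] is nonnegative
    because [s <= t], and the mean value theorem transfers this to [d']. *)
Lemma increment_derive_nd (s t x y : R) : 0 < s -> s <= t -> 0 <= x -> x < y ->
  df (x + t) - df (x + s) <= df (y + t) - df (y + s).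
Proof.
move=> s0 st x0 xy; have t0 : 0 < t by exact: lt_le_trans st.
have [z z0|c [xc cy E]] := @MVT_ge R (fun y => df (y + t) - df (y + s))
  (fun y => ddf (y + t) - ddf (y + s)) 0 x y _ x0 xy.
  exact: is_derive_increment.
rewrite -subr_ge0 E mulr_ge0 ?subr_ge0 ?(ltW xy)// ddf_nd ?lerD2l//.
by rewrite ltr_wpDl// (le_trans x0) ?ltW.
Qed.

(** A convex [d] lies below its chord on [[0, 1]]: its mean slope over [[0, p]] is at most that over
    [[p, 1]], each slope being a value of [d'] at an intermediate point. *)
Lemma increment_chord (s t p : R) : 0 < s -> s <= t -> 0 <= p <= 1 ->
  (f (p + t) - f (p + s)) - (f t - f s)
    <= p * ((f (1 + t) - f (1 + s)) - (f t - f s)).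
Proof.
move=> s0 st /andP[]; rewrite le_eqVlt => /predU1P[<- _|p0].
  by rewrite !add0r mul0r subrr.
rewrite le_eqVlt => /predU1P[->|p1]; first by rewrite mul1r.
have t0 : 0 < t by exact: lt_le_trans st.
set d := fun y => f (y + t) - f (y + s).
set dd := fun y => df (y + t) - df (y + s).
have dE (z : R) : 0 <= z -> is_derive z 1 d (dd z) by exact: is_derive_increment.
have [a [a0 ap Ea]] := MVT_ge dE (lexx 0) p0.
have [b [pb b1 Eb]] := MVT_ge dE (ltW p0) p1.
have ab : dd a <= dd b.
  by apply: increment_derive_nd => //; [exact: ltW|exact: lt_trans pb].
have d0 : d 0 = f t - f s by rewrite /d !add0r.
rewrite -d0 -[f (p + t) - _]/(d p) -[f (1 + t) - _]/(d 1).
have -> : d 1 - d 0 = dd b * (1 - p) + dd a * p.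
  by rewrite -Eb -[p in dd a * p]subr0 -Ea; ring.
rewrite Ea subr0 [leLHS]mulrC ler_pM2l//.
have := ler_wpM2r (ltW (_ : 0 < 1 - p)) ab; rewrite subr_gt0 => /(_ p1).
by rewrite mulrBr mulr1; lra.
Qed.

Lemma sum_increment_le (n : nat) (p : 'I_n -> R) (s t : R) :
  is_prob p -> 0 < s -> s <= t ->
  \sum_(i < n) (f (p i + t) - f t) - (f (1 + t) - f t)
    <= \sum_(i < n) (f (p i + s) - f s) - (f (1 + s) - f s).
Proof.
move=> [p0 p1] s0 st.
set D := (f (1 + t) - f (1 + s)) - (f t - f s).
suff : \sum_(i < n) (f (p i + t) - f t) - \sum_(i < n) (f (p i + s) - f s) <= D.
  by rewrite /D; lra.
(* Since the [p i] sum to 1, [D] is the sum of the [p i * D], and the comparison becomes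
   termwise. *)
rewrite -sumrB -[D]mul1r -p1 mulr_suml; apply: ler_sum => i _.
have pi1 : 0 <= p i <= 1.
  by rewrite p0 -p1 (bigD1 i)//= lerDl sumr_ge0.
by have := increment_chord s0 st pi1; rewrite /D; lra.
Qed.

End nondecreasing_second_derivative.

Definition hypo_phi (R : realType) (q x : R) : R :=
  if q == 1 then - (x * ln x) else x `^ q / (1 - q).

Definition hypo_dphi (R : realType) (q x : R) : R :=
  if q == 1 then - ln x - 1 else q / (1 - q) * x `^ (q - 1).

Lemma is_derive_hypo_phi (R : realType) (q x : R) : 0 < x ->
  is_derive x 1 (hypo_phi q) (hypo_dphi q x).
Proof.
move=> x0; rewrite /hypo_phi /hypo_dphi; case: eqP => [_|/eqP q1].
  have h := is_derive1_ln x0.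
  apply: (@is_derive_eq _ _ _ _ _ _ _ _
    (is_deriveN (is_deriveM (is_derive_id x 1) h))).
  by rewrite /GRing.scale/= mulfV ?gt_eqF// mulr1 opprD addrC.
have h := is_derive1_powR q x0.
have := is_deriveZ (1 - q)^-1 h.
rewrite /GRing.scale/= mulrA [_^-1 * q]mulrC.
by congr is_derive; apply/funext => y; rewrite /= mulrC.
Qed.

Lemma is_derive_hypo_dphi (R : realType) (q x : R) : 0 < x ->
  is_derive x 1 (hypo_dphi q) (- q * x `^ (q - 2)).
Proof.
move=> x0; rewrite /hypo_dphi; case: eqP => [->|/eqP q1].
  have h := is_derive1_ln x0.
  have k := is_deriveB (is_deriveN h) (is_derive_cst (1 : R) x (1 : R)).
  apply: (is_derive_eq k).
  have -> : 1 - 2 = -1 :> R by ring.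
  by rewrite powR_inv1 ?ltW// subr0 mulN1r.
have h := is_derive1_powR (q - 1) x0.
apply: (@is_derive_eq _ _ _ _ _ _ _ _ (is_deriveZ (q / (1 - q)) h)).
have -> : q - 1 - 1 = q - 2 by ring.
rewrite /GRing.scale/=; field.
by rewrite subr_eq0 eq_sym.
Qed.

(** The prefactor [l]^ (1 - q)[exactly cancels the power of]l[in](l * u) [^ (q - 1)]; what still
    depends on [l] is linear in [u]. Only the independence of [C] from [u] matters later. *)
Lemma hypo_phi_homogeneous (R : realType) (q l : R) : 0 < l ->
  exists C, forall u, 0 < u ->
    hpow l q / l * (l * u * lnq q (1 / (l * u))) = hypo_phi q u + C * u.
Proof.
move=> l0; rewrite /hpow /hypo_phi /lnq; case: eqP => [->|/eqP q1].
  exists (- ln l) => u u0; have lu0 : 0 < l * u by rewrite mulr_gt0.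
  rewrite subrr powRr0 div1r lnV ?posrE// lnM ?posrE//.
  by field; rewrite gt_eqF.
exists (- (l `^ (1 - q) / (1 - q))) => u u0.
have lu0 : 0 < l * u by rewrite mulr_gt0.
have q10 : 1 - q != 0 by rewrite subr_eq0 eq_sym.
(* Every power is expressed through [q]-th powers, leaving a rational identity for [field]. *)
have pw (x : R) : 0 < x -> x `^ (1 - q) = x / x `^ q.
  by move=> x0; rewrite powRB ?powRr1 ?ltW// (gt_eqF x0) implybT.
have pq (x : R) : 0 < x -> x `^ q != 0.
  by move=> x0; rewrite gt_eqF// powR_gt0.
rewrite div1r -[(l * u)^-1]powR_inv1 ?ltW// -powRrM mulN1r powRN !pw// powRM ?ltW//.
by field; rewrite q10 !pq// !gt_eqF.
Qed.

(** Apply homogeneity at [u = x + l^-1], with [x = p i] and [x = 1]. The linear terms [C * p i] add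
    up to [C] and cancel the one from [x = 1]. *)
Lemma tsallis_hypoentropyE (R : realType) (n : nat) (p : 'I_n -> R) (q l : R) :
  is_prob p -> 0 < l ->
  tsallis_hypoentropy (@hpow R) l q p =
    \sum_(i < n) (hypo_phi q (p i + l^-1) - hypo_phi q l^-1)
      - (hypo_phi q (1 + l^-1) - hypo_phi q l^-1).
Proof.
move=> [p0 p1] l0; have t0 : 0 < l^-1 by rewrite invr_gt0.
have [C hC] := @hypo_phi_homogeneous R q l l0.
have shift (x : R) : 0 <= x ->
    hpow l q / l * ((1 + l * x) * lnq q (1 / (1 + l * x))) =
    hypo_phi q (x + l^-1) - hypo_phi q l^-1 + C * x.
  move=> x0; have -> : 1 + l * x = l * (x + l^-1).
    by field; rewrite gt_eqF.
  rewrite hC ?ltr_wpDl//.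
  (* At [u = l^-1] the left side of [hC] vanishes, the q-logarithm of 1 being 0. *)
  have : hypo_phi q l^-1 + C * l^-1 = 0.
    rewrite -hC// mulfV ?gt_eqF// divr1 /lnq.
    by rewrite ln1 powR1 subrr mul0r if_same !mulr0.
  by lra.
rewrite /tsallis_hypoentropy mulrDr mulNr mulrN.
have := shift 1 ler01; rewrite mulr1 => ->.
rewrite mulr_sumr (eq_bigr _ (fun i _ => shift (p i) (p0 i))).
by rewrite big_split/= -mulr_sumr p1; ring.
Qed.

Lemma nonpos_powR_ni (R : realType) (a x y : R) : a <= 0 -> 0 < x -> x <= y ->
  y `^ a <= x `^ a.
Proof.
move=> a0 x0 xy; have y0 := lt_le_trans x0 xy.
rewrite -[a]opprK 2!(powRN _ (- a)) lef_pV2 ?posrE ?powR_gt0//.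
by apply: ge0_ler_powR => //; rewrite ?nnegrE ?oppr_ge0// ltW.
Qed.

Theorem lemma4p3 (R : realType) (n : nat) (p : 'I_n -> R) (hp : is_prob p)
    (q : R) :
  (0 <= q <= 2 ->
     forall lambda mu : R, 0 < lambda -> lambda <= mu ->
       tsallis_hypoentropy (@hpow R) lambda q p
         <= tsallis_hypoentropy (@hpow R) mu q p) /\
  (2 <= q \/ q <= 0 ->
     forall lambda mu : R, 0 < lambda -> lambda <= mu ->
       tsallis_hypoentropy (@hpow R) mu q p
         <= tsallis_hypoentropy (@hpow R) lambda q p).
Proof.
have inv_le (l m : R) : 0 < l -> l <= m -> 0 < m^-1 /\ m^-1 <= l^-1.
  move=> l0 lm; have m0 := lt_le_trans l0 lm.
  by rewrite invr_gt0 lef_pV2 ?posrE.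
split=> [/andP[q0 q2]|hq] l m l0 lm;
  have [m1 ml] := inv_le l m l0 lm; have m0 := lt_le_trans l0 lm;
  rewrite !tsallis_hypoentropyE//.
  apply: (sum_increment_le (@is_derive_hypo_phi R q)
    (@is_derive_hypo_dphi R q) _ hp) => // x y x0 xy.
  by rewrite ler_wnM2l ?oppr_le0// nonpos_powR_ni// subr_le0.
have fd (x : R) : 0 < x ->
    is_derive x 1 (fun y => - hypo_phi q y) (- hypo_dphi q x).
  by move=> x0; exact: is_deriveN (is_derive_hypo_phi q x0).
have dfd (x : R) : 0 < x ->
    is_derive x 1 (fun y => - hypo_dphi q y) (- (- q * x `^ (q - 2))).
  by move=> x0; exact: is_deriveN (is_derive_hypo_dphi q x0).
have := @sum_increment_le R _ _ _ fd dfd _ n p m^-1 l^-1 hp m1 ml.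
under eq_bigr do rewrite -opprD.
under [X in _ <= X - _]eq_bigr do rewrite -opprD.
rewrite !sumrN -!opprD lerN2; apply => x y x0 xy.
rewrite !mulNr !opprK; case: hq => hq.
  (* For [2 <= q] factor and exponent are both nonnegative; for [q <= 0] both are nonpositive, so
     the two reversals cancel. *)
  rewrite ler_wpM2l//; first by lra.
  apply: ge0_ler_powR; rewrite ?nnegrE ?subr_ge0//; first exact: ltW.
  by rewrite ltW// (lt_le_trans x0).
by rewrite ler_wnM2l// nonpos_powR_ni//; lra.
Qed.
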